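(* Let $d\ge 1$ and $N\in\mathbb{N}$. For every $f\in\mathcal{NN}(N)$, \[ \kappa(f) \le \inf \left\{ \kappa(\theta): f = f_{\theta} \text{ on } \mathbb{B}^d,\ \theta\in \mathbb{R}^{(d+2)N} \right\}\le 3\kappa(f). \]
   Context: $\sigma(t)=\max\{t,0\}$ is the ReLU function, $\mathbb{B}^d=\{x\in\mathbb{R}^d:\|x\|_2\le 1\}$ and $\mathbb{S}^d=\{v\in\mathbb{R}^{d+1}:\|v\|_2=1\}$. For a parameter vector $\theta=(a_1,w_1^\intercal,\dots,a_N,w_N^\intercal)^\intercal\in\mathbb{R}^{(d+2)N}$ with $a_i\in\mathbb{R}$, $w_i\in\mathbb{R}^{d+1}$, define $f_\theta(x)=\sum_{i=1}^N a_i\sigma((x^\intercal,1)w_i)$ for $x\in\mathbb{B}^d$, and $\kappa(\theta)=\sum_{i=1}^N|a_i|\,\|w_i\|_2$. $\mathcal{NN}(N)=\{f_\theta:\theta\in\mathbb{R}^{(d+2)N}\}$ (functions on $\mathbb{B}^d$). For a finite signed Borel measure $\mu$ on $\mathbb{S}^d$ let $f_\mu(x)=\int_{\mathbb{S}^d}\sigma((x^\intercal,1)v)\,d\mu(v)$, $x\in\mathbb{B}^d$, and let $\|\mu\|=|\mu|(\mathbb{S}^d)$ be its total variation. For a function $f$ of the form $f_\mu$ with $\mu$ a finitely supported (discrete) signed measure, define $\kappa(f)=\inf\{\|\mu\|: \mu \text{ finitely supported signed measure on } \mathbb{S}^d,\ f=f_\mu \text{ on }\mathbb{B}^d\}$.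 *)

(* Defs.v *)
From HB Require Import structures.
From mathcomp Require Import all_boot all_order all_algebra.
From mathcomp Require Import all_classical all_reals.
Set Implicit Arguments. Unset Strict Implicit. Unset Printing Implicit Defensive.
Import Order.TTheory GRing.Theory Num.Theory.
Local Open Scope ring_scope.
Local Open Scope classical_set_scope.

Section Defs.
Variables (R : realType) (d : nat).

Definition relu (t : R) : R := Num.max t 0.

Definition dotv (n : nat) (u v : 'rV[R]_n) : R := \sum_(i < n) u 0 i * v 0 i.
Definition norm2 (n : nat) (v : 'rV[R]_n) : R := Num.sqrt (dotv v v).

Definition in_ball (x : 'rV[R]_d) : Prop := norm2 x <= 1.
Definition in_sphere (v : 'rV[R]_(d + 1)) : Prop := norm2 v = 1.

Definition aug (x : 'rV[R]_d) : 'rV[R]_(d + 1) := row_mx x (1 : 'rV[R]_1).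

Definition fnn (N : nat) (a : 'I_N -> R) (w : 'I_N -> 'rV[R]_(d + 1))
  (x : 'rV[R]_d) : R := \sum_(i < N) a i * relu (dotv (aug x) (w i)).

Definition kappa_par (N : nat) (a : 'I_N -> R) (w : 'I_N -> 'rV[R]_(d + 1)) : R :=
  \sum_(i < N) `|a i| * norm2 (w i).

Definition in_NN (N : nat) (f : 'rV[R]_d -> R) : Prop :=
  exists (a : 'I_N -> R) (w : 'I_N -> 'rV[R]_(d + 1)),
    forall x, in_ball x -> f x = fnn a w x.

(* A finitely supported signed measure on S^d is encoded as a list of
   (weight, atom) pairs with pairwise distinct atoms on S^d; its total
   variation is then the sum of the absolute weights. *)
Definition fmeas_ok (s : seq (R * 'rV[R]_(d + 1))) : Prop :=
  uniq (map snd s) /\ forall p, p \in s -> in_sphere p.2.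

Definition f_meas (s : seq (R * 'rV[R]_(d + 1))) (x : 'rV[R]_d) : R :=
  \sum_(p <- s) p.1 * relu (dotv (aug x) p.2).

Definition tv_meas (s : seq (R * 'rV[R]_(d + 1))) : R :=
  \sum_(p <- s) `|p.1|.

Definition kappa_fun (f : 'rV[R]_d -> R) : R :=
  inf [set r : R | exists s, fmeas_ok s /\
        (forall x, in_ball x -> f x = f_meas s x) /\ r = tv_meas s].

Definition kappa_rep (N : nat) (f : 'rV[R]_d -> R) : R :=
  inf [set r : R | exists (a : 'I_N -> R) (w : 'I_N -> 'rV[R]_(d + 1)),
        (forall x, in_ball x -> f x = fnn a w x) /\ r = kappa_par a w].

End Defs.

(* Main.v *)
(** A neuron whose hyperplane misses the open ball is linear on the ball, and
    relu t - relu (- t) = t, so every network is, on the ball, a sum of neurons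
    c v * relu (dotv z v) over pairwise non-proportional hyperplanes meeting the
    open ball, plus a linear term dotv z u.  The kinks determine the c v, hence u,
    so that measuring any other representation s of the same function against the
    same orientations bounds both the sum of the |c v| |v| and |u| by the total
    variation of s.  It remains to express the linear term without using more
    neurons than the original network had.  If the network has no neuron beyond
    one per hyperplane then u = 0; with one extra neuron, u has constant sign on
    the ball or is proportional to some v; with two, relu t - relu (- t) = t
    represents any u.  In each case the extra cost is at most 2 |u|, whence the
    factor 3. *)
Require Import Defs.
From mathcomp Require Import all_boot all_order all_algebra.
From mathcomp Require Import all_classical all_reals.
From mathcomp Require Import ring lra.
Import Order.TTheory GRing.Theory Num.Theory.
Local Open Scope ring_scope.
Set Implicit Arguments. Unset Strict Implicit. Unset Printing Implicit Defensive.

(** * The Euclidean inner product and norm *)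

Section Euclidean.
Variables (R : realType) (n : nat).
Implicit Types (u v w : 'rV[R]_n) (k : R).

Lemma dotvC u v : dotv u v = dotv v u.
Proof. by apply: eq_bigr => i _; rewrite mulrC. Qed.

Lemma dotvDl u v w : dotv (u + v) w = dotv u w + dotv v w.
Proof. by rewrite -big_split; apply: eq_bigr => i _; rewrite mxE mulrDl. Qed.

Lemma dotvZl k u v : dotv (k *: u) v = k * dotv u v.
Proof. by rewrite /dotv mulr_sumr; apply: eq_bigr => i _; rewrite mxE mulrA. Qed.

Lemma dotvDr u v w : dotv w (u + v) = dotv w u + dotv w v.
Proof. by rewrite dotvC dotvDl !(dotvC w). Qed.

Lemma dotvZr k u v : dotv v (k *: u) = k * dotv v u.
Proof. by rewrite dotvC dotvZl (dotvC v). Qed.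

Lemma dotvNr u v : dotv v (- u) = - dotv v u.
Proof. by rewrite -scaleN1r dotvZr mulN1r. Qed.

Lemma dotv0r v : dotv v 0 = 0.
Proof. by rewrite -(scale0r v) dotvZr mul0r. Qed.

Lemma dotv_ge0 v : 0 <= dotv v v.
Proof. by apply: sumr_ge0 => i _; rewrite -expr2 sqr_ge0. Qed.

Lemma dotv_eq0 v : dotv v v = 0 -> v = 0.
Proof.
move=> /eqP; rewrite psumr_eq0 => [/allP h|i _]; last by rewrite -expr2 sqr_ge0.
apply/rowP => i; rewrite mxE; apply/eqP.
by have := h i (mem_index_enum _); rewrite /= mulf_eq0 orbb.
Qed.

Lemma norm2_ge0 v : 0 <= norm2 v.
Proof. exact: sqrtr_ge0. Qed.

Lemma norm2_sqr v : norm2 v ^+ 2 = dotv v v.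
Proof. by rewrite sqr_sqrtr // dotv_ge0. Qed.

Lemma norm2Z k v : norm2 (k *: v) = `|k| * norm2 v.
Proof. by rewrite /norm2 dotvZl dotvZr mulrA -expr2 sqrtrM ?sqr_ge0 // sqrtr_sqr. Qed.

Lemma norm2N v : norm2 (- v) = norm2 v.
Proof. by rewrite -scaleN1r norm2Z normrN1 mul1r. Qed.

Lemma norm20 : norm2 (0 : 'rV[R]_n) = 0.
Proof. by rewrite -(scale0r 0) norm2Z normr0 mul0r. Qed.

Lemma norm2_eq0 v : norm2 v = 0 -> v = 0.
Proof. by move=> h; apply: dotv_eq0; rewrite -norm2_sqr h expr0n. Qed.

Lemma dotv_CauchySchwarz u v : dotv u v ^+ 2 <= dotv u u * dotv v v.
Proof.
have [/dotv_eq0->|v0] := eqVneq (dotv v v) 0; first by rewrite !dotv0r expr0n mulr0.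
have vpos : 0 < dotv v v by rewrite lt_def v0 dotv_ge0.
have := dotv_ge0 (dotv v v *: u + (- dotv u v) *: v).
rewrite !(dotvDl, dotvDr, dotvZl, dotvZr) (dotvC v u) => h.
rewrite -subr_ge0 -(pmulr_rge0 _ vpos); lra.
Qed.

Lemma norm2D u v : norm2 (u + v) <= norm2 u + norm2 v.
Proof.
rewrite -(@ler_pXn2r _ 2) ?nnegrE ?addr_ge0 ?norm2_ge0 //.
rewrite norm2_sqr dotvDl !dotvDr (dotvC v u) sqrrD !norm2_sqr.
suff : dotv u v <= norm2 u * norm2 v by move=> h; lra.
apply: le_trans (ler_norm _) _.
rewrite -(@ler_pXn2r _ 2) ?nnegrE ?mulr_ge0 ?norm2_ge0 //.
by rewrite exprMn !norm2_sqr real_normK ?num_real // dotv_CauchySchwarz.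
Qed.

End Euclidean.

(** * Elementary identities of the ReLU *)

Section Relu.
Variable R : realType.
Implicit Types s t k : R.

Lemma relu_ge0 t : 0 <= t -> relu t = t.
Proof. by move=> h; rewrite /relu max_l. Qed.

Lemma relu_le0 t : t <= 0 -> relu t = 0.
Proof. by move=> h; rewrite /relu max_r. Qed.

Lemma relu_subN t : relu t - relu (- t) = t.
Proof.
have [h|h] := leP 0 t; first by rewrite relu_ge0 // relu_le0; lra.
by rewrite relu_le0 ?relu_ge0; lra.
Qed.

Lemma reluM k t : 0 <= k -> relu (k * t) = k * relu t.
Proof.
move=> k0; have [h|h] := leP 0 t; first by rewrite !relu_ge0 // mulr_ge0.
have kt0 : k * t <= 0 by rewrite mulr_ge0_le0 // ltW.
by rewrite (relu_le0 kt0) (relu_le0 (ltW h)) mulr0.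
Qed.

(** The points [s + t] and [s - t] stay on the same closed side of the kink as [s], where [relu] is
    linear. *)
Lemma relu_second_difference s t :
  `|t| <= `|s| -> relu (s + t) + relu (s - t) - 2 * relu s = 0.
Proof.
rewrite ler_norml => /andP[h1 h2].
have [h|h] := leP 0 s.
  by move: h1 h2; rewrite ger0_norm // => h1 h2; rewrite !relu_ge0; lra.
by move: h1 h2; rewrite ltr0_norm // => h1 h2; rewrite !relu_le0; lra.
Qed.

End Relu.

(** * Finite sums against finitely supported weights *)

Section WeightedSums.
Variables (R : realType) (T : choiceType).
Implicit Types (V : seq T) (c g : T -> R).

Lemma big_seq_support V V' g :
  uniq V -> uniq V' -> {subset V <= V'} -> {in [predC V], g =1 (fun=> 0)} ->
  \sum_(v <- V') g v = \sum_(v <- V) g v.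
Proof.
move=> uV uV' sVV' g0.
rewrite (bigID (mem V)) /= [X in _ + X]big1 ?addr0; last by move=> v /g0.
rewrite -big_filter; apply: perm_big; apply: uniq_perm => //.
  exact: filter_uniq.
by move=> v; rewrite mem_filter andb_idr //; apply: sVV'.
Qed.

(** Serves to merge a new neuron with one already listed instead of appending it. *)
Definition add_weight c v k : T -> R := fun x => c x + (if x == v then k else 0).

Lemma sum_add_weight V c v k g : uniq V -> v \in V ->
  \sum_(x <- V) add_weight c v k x * g x = \sum_(x <- V) c x * g x + k * g v.
Proof.
move=> uV vV; rewrite -[k * g v](_ : \sum_(x <- V) (if x == v then k else 0) * g x = _).
  by rewrite -big_split; apply: eq_bigr => x _; rewrite mulrDl.
rewrite (bigD1_seq v) //= eqxx big1 ?addr0 // => x /negPf->.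
by rewrite mul0r.
Qed.

Lemma sum_norm_add_weight V c v k g : uniq V -> v \in V ->
  (forall x, 0 <= g x) ->
  \sum_(x <- V) `|add_weight c v k x| * g x
    <= \sum_(x <- V) `|c x| * g x + `|k| * g v.
Proof.
move=> uV vV g0; rewrite -(sum_add_weight (fun x => `|c x|)) //.
apply: ler_sum => x _; apply: ler_wpM2r => //.
by apply: le_trans (ler_normD _ _) _; rewrite /add_weight; case: ifP; rewrite ?normr0.
Qed.

Lemma add_weight_support V c v k : v \in V -> {in [predC V], c =1 (fun=> 0)} ->
  {in [predC V], add_weight c v k =1 (fun=> 0)}.
Proof.
move=> vV c0 x xV; rewrite /add_weight c0 // add0r; case: eqP => // xv.
by move: xV; rewrite inE xv vV.
Qed.

End WeightedSums.

(** * Properties that hold for all small perturbations *)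

Section SmallPerturbations.
Variable R : realType.
Implicit Types P Q : R -> Prop.

Definition for_small (P : R -> Prop) :=
  exists2 e : R, 0 < e & forall h, `|h| < e -> P h.

Lemma for_small_and P Q : for_small P -> for_small Q ->
  for_small (fun h => P h /\ Q h).
Proof.
move=> [e e0 eP] [e' e'0 eQ]; exists (Num.min e e'); first by rewrite lt_min e0.
by move=> h; rewrite lt_min => /andP[/eP ? /eQ].
Qed.

Lemma for_small_mono (P Q : R -> Prop) :
  (forall h, P h -> Q h) -> for_small P -> for_small Q.
Proof. by move=> PQ [e e0 eP]; exists e => // h /eP/PQ. Qed.

Lemma for_small_all (T : eqType) (V : seq T) (P : T -> R -> Prop) :
  (forall v, v \in V -> for_small (P v)) ->
  for_small (fun h => forall v, v \in V -> P v h).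
Proof.
elim: V => [|v V ih] hP; first by exists 1.
have h1 := hP v (mem_head _ _).
have := ih (fun w wV => hP w (mem_behead (s := v :: V) wV)).
move=> /(for_small_and h1); apply: for_small_mono => h [Pv PV] w.
by rewrite inE => /orP[/eqP->|/PV].
Qed.

(** Both signs are kept because a symmetric second difference evaluates at [h] and [- h]. *)
Lemma for_small_pos P : for_small P -> exists2 h, 0 < h & P h /\ P (- h).
Proof.
move=> [e e0 eP]; exists (e / 2); first by lra.
by split; apply: eP; rewrite ?normrN gtr0_norm; lra.
Qed.

Lemma for_small_linear (a b : R) : 0 < a -> for_small (fun h => `|h * b| < a).
Proof.
move=> a0; have b1 : 0 < `|b| + 1 by rewrite ltr_wpDl.
exists (a / (`|b| + 1)); first exact: divr_gt0.
move=> h; rewrite ltr_pdivlMr // normrM; apply: le_lt_trans.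
by rewrite ler_wpM2l // lerDl.
Qed.

Lemma for_small_quadratic (a b c : R) : 0 < a ->
  for_small (fun h => 0 < a + h * b + h ^+ 2 * c).
Proof.
move=> a0; have a2 : 0 < a / 2 by lra.
have h1 : for_small (fun h : R => `|h| < 1) by exists 1.
have := for_small_and h1 (for_small_and (for_small_linear b a2) (for_small_linear c a2)).
apply: for_small_mono => h [h1' [hb hc]].
have hhc : `|h ^+ 2 * c| < a / 2.
  apply: le_lt_trans hc; rewrite expr2 -mulrA normrM.
  by rewrite ler_piMl // ltW.
by move: hb hhc; rewrite !ltr_norml => /andP[? ?] /andP[? ?]; lra.
Qed.

End SmallPerturbations.

(** * Neurons on the ball and on the open cone above it *)

Section Ball.
Variables (R : realType) (d : nat).
Implicit Types (u v w z y : 'rV[R]_(d + 1)) (V : seq 'rV[R]_(d + 1)).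
Implicit Types (l s : seq (R * 'rV[R]_(d + 1))) (x : 'rV[R]_d).

(** A neuron with such a weight is linear on the ball, so it has no kink there to detect. *)
Definition flat w :=
  (forall x, in_ball x -> 0 <= dotv (aug x) w) \/
  (forall x, in_ball x -> dotv (aug x) w <= 0).

Lemma flat0 : flat 0.
Proof. by left=> x _; rewrite dotv0r. Qed.

Lemma flatZ k w : flat w -> flat (k *: w).
Proof.
have [k0|/ltW k0] := leP 0 k; case=> h; [left|right|right|left] => x /h hx;
  rewrite dotvZr; nra.
Qed.

(** The open cone spanned by the [aug x] with [x] in the open ball. Unlike the points [aug x], those
    of the cone can be perturbed in every direction. *)
Definition in_cone z :=
  0 < rsubmx z 0 0 /\ dotv (lsubmx z) (lsubmx z) < rsubmx z 0 0 ^+ 2.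

Lemma in_ballE x : in_ball x <-> dotv x x <= 1.
Proof.
rewrite /in_ball -norm2_sqr; split=> h; first by rewrite expr_le1 ?norm2_ge0.
by rewrite -(@expr_le1 _ 2) ?norm2_ge0.
Qed.

Lemma in_cone_aug z : in_cone z ->
  exists k x, [/\ 0 < k, in_ball x & z = k *: aug x].
Proof.
move=> [s0 zs]; exists (rsubmx z 0 0), ((rsubmx z 0 0)^-1 *: lsubmx z).
split=> //.
  apply/in_ballE; rewrite dotvZl dotvZr mulrA -expr2 exprVn.
  by rewrite mulrC ler_pdivrMr ?exprn_gt0 // mul1r ltW.
rewrite /aug scale_row_mx scalerA divff ?gt_eqF // scale1r.
rewrite -[LHS]hsubmxK; congr row_mx.
by apply/rowP => i; rewrite !ord1 !mxE mulr1.
Qed.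

Lemma aug_in_cone x : dotv x x < 1 -> in_cone (aug x).
Proof. by move=> h; split; rewrite /aug row_mxKr ?row_mxKl mxE // expr1n. Qed.

(** Each defining inequality becomes the positivity of a polynomial in [h] of degree at most two,
    already positive at [h = 0]. *)
Lemma in_cone_open z y : in_cone z -> for_small (fun h => in_cone (z + h *: y)).
Proof.
move=> [s0 zs].
set s := rsubmx z 0 0 in s0 zs *; set t := rsubmx y 0 0.
set p := lsubmx z in zs *; set q := lsubmx y.
have h1 := for_small_quadratic t 0 s0.
have zs' : 0 < s ^+ 2 - dotv p p by lra.
have h2 := for_small_quadratic (2 * s * t - 2 * dotv p q) (t ^+ 2 - dotv q q) zs'.
apply: for_small_mono (for_small_and h1 h2) => h [H1 H2].
rewrite /in_cone linearD linearZ /= linearD linearZ /= -/p -/q.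
rewrite !(dotvDl, dotvDr, dotvZl, dotvZr) (dotvC q p).
have -> : (rsubmx z + h *: rsubmx y) 0 0 = s + h * t by rewrite !mxE /s /t !mxE.
by split; [lra|nra].
Qed.

(** The affine function [g] vanishes at the centre or takes the opposite sign at some [x] of the
    ball; its root on the segment to [x] then comes strictly before [x], hence in the open ball. *)
Lemma not_flat_vanishes v : ~ flat v -> exists2 z, in_cone z & dotv z v = 0.
Proof.
move=> nf; pose g x := dotv (aug x) v.
have [g0|g0] := eqVneq (g 0) 0.
  by exists (aug 0) => //; apply: aug_in_cone; rewrite dotv0r.
have [x [bx gx]] : exists x, in_ball x /\ g x * g 0 < 0.
  apply: contrapT => nx; apply: nf.
  case/lt_total/orP : g0 => g0; [right|left] => x bx;
    rewrite leNgt; apply/negP => gx; apply: nx; exists x; split=> //;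
    rewrite /g in g0 *; nra.
have gE t : g (t *: x) = g 0 + t * (g x - g 0).
  rewrite /g -[aug (t *: x)](_ : aug 0 + t *: (aug x - aug 0) = _).
    by rewrite dotvDl dotvZl dotvDl -scaleN1r dotvZl mulN1r.
  rewrite /aug opp_row_mx add_row_mx scale_row_mx add_row_mx.
  by rewrite subr0 subrr scaler0 addr0 add0r.
have dg : g 0 - g x != 0 by apply/eqP => e; nra.
have tE : g 0 / (g 0 - g x) * (g 0 - g x) = g 0 by rewrite divfK.
set t := g 0 / _ in tE.
have t0 : 0 <= t by nra.
have t1 : t < 1 by nra.
exists (aug (t *: x)); last by rewrite -/(g _) gE; lra.
apply: aug_in_cone; rewrite dotvZl dotvZr.
by move/in_ballE : bx => bx; have := dotv_ge0 x; nra.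
Qed.

(** * Independence of neurons with distinct hyperplanes *)

(** Negative [k] is excluded too: the neurons of [v] and [- v] differ by a linear function, so they
    would not be independent of the linear part. *)
Definition nonparallel V := [/\ uniq V, forall v, v \in V -> ~ flat v
  & forall v w, v \in V -> w \in V -> v != w -> forall k, w <> k *: v].

Lemma nonparallel_nil : nonparallel [::].
Proof. by []. Qed.

Lemma nonparallel_cons V w : nonparallel V -> ~ flat w ->
  (forall v k, v \in V -> w <> k *: v) -> nonparallel (w :: V).
Proof.
move=> [uV nfV npV] nfw npw; split.
- by rewrite /= uV andbT; apply/negP => /(npw _ 1); rewrite scale1r.
- by move=> v; rewrite inE => /orP[/eqP->|/nfV].
- move=> v v'; rewrite !inE => /orP[/eqP->|vV] /orP[/eqP->|v'V] vv' k.
  + by rewrite eqxx in vv'.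
  (* Only [w] being a multiple of [v'] is excluded by hypothesis; the converse follows by inverting
     [k], which is nonzero since [v'] is not flat. *)
  + move=> v'E; have [k0|k0] := eqVneq k 0.
      by apply: (nfV _ v'V); rewrite v'E k0 scale0r; apply: flat0.
    by apply: (npw v' k^-1 v'V); rewrite v'E scalerA mulVf // scale1r.
  + exact: npw.
  + exact: npV.
Qed.

(** Induction on [V]. If [z] lies on the hyperplane of the new [w], it is moved along the component
    [y] of [w] orthogonal to [v]: this stays on the hyperplane of [v], leaves that of [w], and a
    small move meets none of the others. *)
Lemma generic_point V v : ~ flat v ->
  (forall w, w \in V -> forall k, w <> k *: v) ->
  exists z, [/\ in_cone z, dotv z v = 0 & forall w, w \in V -> dotv z w != 0].
Proof.
move=> nfv; elim: V => [|w V ih] hV.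
  by have [z zC zv] := not_flat_vanishes nfv; exists z.
have [|z [zC zv zV]] := ih; first by move=> w' w'V; apply: hV; rewrite inE w'V orbT.
have [zw|zw] := eqVneq (dotv z w) 0; last first.
  by exists z; split=> // w'; rewrite inE => /orP[/eqP->|/zV].
have vv0 : dotv v v != 0.
  by apply/eqP => /dotv_eq0 v0; apply: nfv; rewrite v0; apply: flat0.
pose k := dotv w v / dotv v v; pose y := w - k *: v.
have yv : dotv y v = 0.
  by rewrite /y dotvDl -scaleNr dotvZl /k mulNr divfK // subrr.
have yw : dotv y w != 0.
  have -> : dotv y w = dotv y y by rewrite {3}/y dotvDr -scaleNr dotvZr yv mulr0 addr0.
  apply/eqP => /dotv_eq0 /eqP; rewrite subr_eq0 => /eqP.
  exact: (hV _ (mem_head _ _)).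
have smallV : for_small (fun h => forall w', w' \in V -> dotv (z + h *: y) w' != 0).
  apply: for_small_all => w' w'V; have := zV _ w'V; rewrite -normr_gt0 => zw'.
  apply: for_small_mono (for_small_linear (dotv y w') zw') => h.
  rewrite dotvDl dotvZl => lth; apply/eqP => /eqP; rewrite addr_eq0 => /eqP e.
  by rewrite e normrN ltxx in lth.
have [h h0 [[zhC zhV] _]] :=
  for_small_pos (for_small_and (in_cone_open y zC) smallV).
exists (z + h *: y); split=> //; first by rewrite dotvDl dotvZl yv zv mulr0 addr0.
move=> w'; rewrite inE => /orP[/eqP->|/zhV//].
by rewrite dotvDl dotvZl zw add0r mulf_neq0 // gt_eqF.
Qed.

Definition relu_sum V (c : 'rV[R]_(d + 1) -> R) z :=
  \sum_(v <- V) c v * relu (dotv z v).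

Lemma relu_sum_cone V c u :
  (forall x, in_ball x -> relu_sum V c (aug x) + dotv (aug x) u = 0) ->
  forall z, in_cone z -> relu_sum V c z + dotv z u = 0.
Proof.
move=> h z /in_cone_aug[k [x [k0 bx ->]]].
suff -> : relu_sum V c (k *: aug x) = k * relu_sum V c (aug x).
  by rewrite dotvZl -mulrDr h // mulr0.
rewrite /relu_sum mulr_sumr; apply: eq_bigr => v _.
by rewrite dotvZl reluM ?ltW // mulrCA.
Qed.

(* The second difference along [v] at a generic zero [z] of [dotv _ v]
   annihilates every other neuron and the linear part. *)
Lemma relu_sum_independent V c u : nonparallel V ->
  (forall x, in_ball x -> relu_sum V c (aug x) + dotv (aug x) u = 0) ->
  {in V, c =1 (fun=> 0)} /\ u = 0.
Proof.
move=> [uV nfV npV] /relu_sum_cone h0.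
have c0 : {in V, c =1 (fun=> 0)}.
  move=> v vV.
  have [|z [zC zv zV]] := @generic_point (rem v V) v (nfV v vV).
    move=> w; rewrite mem_rem_uniq // inE => /andP[wv wV].
    by apply: npV => //; rewrite eq_sym.
  have smallV : for_small (fun h => forall w, w \in rem v V ->
      `|h * dotv v w| < `|dotv z w|).
    by apply: for_small_all => w /zV zw; apply: for_small_linear; rewrite normr_gt0.
  have [h hpos [[hC hV] [hC' _]]] :=
    for_small_pos (for_small_and (in_cone_open v zC) smallV).
  have := h0 _ hC; have := h0 _ hC'; have := h0 _ zC.
  rewrite !(dotvDl _ _ u) !(dotvZl _ _ u) => e1 e2 e3.
  have : relu_sum V c (z + h *: v) + relu_sum V c (z + (- h) *: v)
         - 2 * relu_sum V c z = 0 by lra.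
  rewrite /relu_sum mulr_sumr -sumrN -!big_split (bigD1_seq v) //= [X in _ + X]big1_seq.
    (* The neuron [v], whose argument is zero at [z], contributes [c v * (h * dotv v v)], which
       forces [c v = 0]. *)
    rewrite addr0 !dotvDl !dotvZl zv !add0r (relu_le0 (lexx 0)) mulNr.
    have hv : 0 < h * dotv v v.
      rewrite mulr_gt0 // lt_def dotv_ge0 andbT; apply/eqP => /dotv_eq0 v0.
      by apply: (nfV v vV); rewrite v0; apply: flat0.
    rewrite (relu_ge0 (ltW hv)) relu_le0 ?oppr_le0 ?ltW // !mulr0 oppr0 !addr0.
    by move=> /eqP; rewrite mulf_eq0 (gt_eqF hv) orbF => /eqP.
  move=> w /andP[wv wV].
  have wr : w \in rem v V by rewrite mem_rem_uniq // inE wv.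
  have := relu_second_difference (ltW (hV w wr)).
  rewrite !dotvDl !dotvZl mulNr => e.
  by rewrite -[RHS](mulr0 (c w)) -e; ring.
split=> //.
(* Only the linear part is left; moving from the centre in the direction [u] itself yields
   [h * dotv u u = 0]. *)
have hu z : in_cone z -> dotv z u = 0.
  move=> /h0; rewrite /relu_sum big1_seq ?add0r // => v /andP[_ vV].
  by rewrite c0 // mul0r.
have oC : in_cone (aug (0 : 'rV[R]_d)) by apply: aug_in_cone; rewrite dotv0r.
have [h hpos [hC _]] := for_small_pos (in_cone_open u oC).
have := hu _ hC; rewrite dotvDl dotvZl (hu _ oC) add0r => /eqP.
by rewrite mulf_eq0 gt_eqF //= => /eqP/dotv_eq0.
Qed.

(** * Normal forms of networks and their neuron count *)

Definition kappa_seq l := \sum_(p <- l) `|p.1| * norm2 p.2.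

Definition norm_sum V (c : 'rV[R]_(d + 1) -> R) := \sum_(v <- V) `|c v| * norm2 v.

Lemma neuron_flat a w : flat w ->
  exists u, [/\ flat u, norm2 u <= `|a| * norm2 w
  & forall x, in_ball x -> a * relu (dotv (aug x) w) = dotv (aug x) u].
Proof.
move=> fw; case: (fw) => h.
  exists (a *: w); split; [exact: flatZ|by rewrite norm2Z|] => x /h hx.
  by rewrite relu_ge0 // dotvZr.
exists 0; split; [exact: flat0|by rewrite norm20 mulr_ge0 ?norm2_ge0|] => x /h hx.
by rewrite relu_le0 // dotv0r mulr0.
Qed.

(** For [k < 0], [relu (k * t) = - k * relu (- t)] and [relu (- t) = relu t - t], so the linear term
    costs as much as the neuron. *)
Lemma neuron_parallel a k v :
  exists b c, [/\ `|b| <= `|a| * `|k|, `|c| <= `|a| * `|k|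
  & forall z, a * relu (dotv z (k *: v)) = c * relu (dotv z v) + b * dotv z v].
Proof.
have [k0|k0] := leP 0 k.
  exists 0, (a * k); split; rewrite ?normr0 ?normrM ?mulr_ge0 // => z.
  by rewrite dotvZr reluM // mulrA mul0r addr0.
exists (a * k), (- (a * k)); split; rewrite ?normrN ?normrM // => z.
rewrite dotvZr -(mulrNN k) reluM ?oppr_ge0 ?ltW //.
by rewrite -[X in _ + _ * X]relu_subN; ring.
Qed.

(* A combination of [size V] neurons plus a linear term [u], obtained from [m]
   neurons: the surplus [m - size V] limits which [u] can occur. *)
Definition surplus m V u :=
  [\/ size V = m /\ u = 0,
      (size V).+1 = m /\ (flat u \/ exists v b, v \in V /\ u = b *: v)
    | ((size V).+2 <= m)%N].

Lemma normal_form V0 l : nonparallel V0 -> exists V c u,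
  [/\ nonparallel V /\ {subset V0 <= V}, {in [predC V], c =1 (fun=> 0)},
      forall x, in_ball x -> f_meas l x = relu_sum V c (aug x) + dotv (aug x) u,
      norm_sum V c <= kappa_seq l /\ norm2 u <= kappa_seq l
    & surplus (size l + size V0) V u].
Proof.
move=> npV0; elim: l => [|[a w] l [V [c [u [[npV sV] c0 lE [cl ul] sur]]]]].
  exists V0, (fun=> 0), 0; split=> //; first by split.
  - by move=> x _; rewrite /f_meas /relu_sum big_nil dotv0r addr0 big1 // => v; rewrite mul0r.
  - rewrite /norm_sum /kappa_seq big_nil norm20; split=> //.
    by rewrite big1 // => v; rewrite normr0 mul0r.
  - by apply: Or31; rewrite add0n.
have aw0 : 0 <= `|a| * norm2 w by rewrite mulr_ge0 // norm2_ge0.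
have kE : kappa_seq ((a, w) :: l) = `|a| * norm2 w + kappa_seq l.
  by rewrite /kappa_seq big_cons.
have fE x : f_meas ((a, w) :: l) x = a * relu (dotv (aug x) w) + f_meas l x.
  by rewrite /f_meas big_cons.
have [fw|nfw] := pselect (flat w).
  have [u' [fu' u'aw u'E]] := neuron_flat a fw.
  exists V, c, (u' + u); split=> //.
  - by move=> x bx; rewrite fE lE // u'E // dotvDr; ring.
  - rewrite kE; split; first by rewrite ler_wpDl.
    by apply: le_trans (norm2D _ _) _; rewrite lerD.
  - case: sur => [[sE ->]|[sE _]|sE].
    + by apply: Or32; rewrite addr0 sE; split; [|left].
    + by apply: Or33; rewrite sE.
    + by apply: Or33; rewrite /= addSn; apply: leqW.
have [[v [k [vV wE]]]|nw] := pselect (exists v k, v \in V /\ w = k *: v).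
  have [b [g [bak gak vE]]] := neuron_parallel a k v.
  have [uV _ _] := npV.
  have gv : `|g| * norm2 v <= `|a| * norm2 w.
    by rewrite wE norm2Z mulrA ler_wpM2r ?norm2_ge0.
  exists V, (add_weight c v g), (b *: v + u); split=> //.
  - exact: add_weight_support.
  - move=> x bx; rewrite fE lE // wE vE dotvDr dotvZr /relu_sum sum_add_weight //.
    ring.
  - rewrite kE; split.
      apply: le_trans (sum_norm_add_weight c g uV vV (@norm2_ge0 _ _)) _.
      by rewrite addrC lerD.
    apply: le_trans (norm2D _ _) _; rewrite lerD // norm2Z wE norm2Z mulrA.
    by rewrite ler_wpM2r ?norm2_ge0.
  - case: sur => [[sE ->]|[sE _]|sE].
    + by apply: Or32; rewrite addr0 sE; split=> //; right; exists v, b.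
    + by apply: Or33; rewrite sE.
    + by apply: Or33; rewrite /= addSn; apply: leqW.
have npw v k : v \in V -> w <> k *: v by move=> vV wE; apply: nw; exists v, k.
have npV' := nonparallel_cons npV nfw npw.
have [uV' _ _] := npV'.
(* The support condition ensures that the new [w] starts with weight zero and so ends with exactly
   [a]. *)
have cw : c w = 0.
  by apply: c0; rewrite inE; apply/negP => /(npw _ 1); rewrite scale1r.
have cE g : \sum_(v <- w :: V) c v * g v = \sum_(v <- V) c v * g v.
  by rewrite big_cons cw mul0r add0r.
have c0' : {in [predC w :: V], c =1 (fun=> 0)}.
  by move=> v; rewrite !inE negb_or => /andP[_ vV]; apply: c0.
exists (w :: V), (add_weight c w a), u; split=> //.
- by split=> // v /sV vV; rewrite inE vV orbT.
- by apply: add_weight_support => //; apply: mem_head.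
- move=> x bx; rewrite fE lE // /relu_sum sum_add_weight ?mem_head // cE; ring.
- rewrite kE; split; last by rewrite ler_wpDl.
  apply: le_trans (sum_norm_add_weight c a uV' (mem_head _ _) (@norm2_ge0 _ _)) _.
  by rewrite addrC lerD // big_cons cw normr0 mul0r add0r.
- case: sur => [[sE ->]|[sE fu]|sE].
  + by apply: Or31; rewrite /= sE.
  + apply: Or32; rewrite /= sE; split=> //; case: fu => [|[v [b [vV uE]]]]; first by left.
    by right; exists v, b; rewrite inE vV orbT.
  + exact: Or33.
Qed.

(** The number of spare neurons decides how [u] is written, at a cost of zero, [norm2 u] or
    [2 * norm2 u]. *)
Lemma surplus_realizable m V c u : uniq V -> surplus m V u -> exists l,
  [/\ (size l <= m)%N,
      forall x, in_ball x -> f_meas l x = relu_sum V c (aug x) + dotv (aug x) u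
    & kappa_seq l <= norm_sum V c + 2 * norm2 u].
Proof.
move=> uV.
pose l0 c' := [seq (c' v, v) | v <- V] : seq (R * 'rV[R]_(d + 1)).
have l0E c' x : f_meas (l0 c') x = relu_sum V c' (aug x) by rewrite /f_meas big_map.
have kE c' : kappa_seq (l0 c') = norm_sum V c' by rewrite /kappa_seq big_map.
have fE p l x : f_meas (p :: l) x = p.1 * relu (dotv (aug x) p.2) + f_meas l x.
  by rewrite /f_meas big_cons.
have kcE p l : kappa_seq (p :: l) = `|p.1| * norm2 p.2 + kappa_seq l.
  by rewrite /kappa_seq big_cons.
have u0 := norm2_ge0 u.
case=> [[sE ->]|[sE [fu|[v [b [vV uE]]]]]|sE].
- exists (l0 c); split; first by rewrite size_map sE.
    by move=> x _; rewrite l0E dotv0r addr0.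
  by rewrite kE norm20 mulr0 addr0.
- case: fu => hu.
    exists ((1, u) :: l0 c); split; first by rewrite /= size_map sE.
      by move=> x /hu hx; rewrite fE l0E /= relu_ge0 // mul1r addrC.
    by rewrite kcE kE /= normr1; lra.
  exists ((-1, - u) :: l0 c); split; first by rewrite /= size_map sE.
    move=> x /hu hx; rewrite fE l0E /= dotvNr relu_ge0 ?oppr_ge0 //.
    by rewrite mulN1r opprK addrC.
  by rewrite kcE kE /= normrN1 norm2N; lra.
(* Here [b * t] is [b * relu t - b * relu (- t)]. The first term merges into the existing neuron
   [v], so one spare neuron suffices. *)
- exists ((- b, - v) :: l0 (add_weight c v b)); split.
  + by rewrite /= size_map sE.
  + move=> x _; rewrite fE l0E /= dotvNr uE dotvZr /relu_sum sum_add_weight //.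
    by rewrite -[X in _ = _ + _ * X]relu_subN; ring.
  + rewrite kcE kE /= normrN norm2N uE norm2Z.
    have := sum_norm_add_weight c b uV vV (@norm2_ge0 R (d + 1)).
    by rewrite -/(norm_sum V _) -/(norm_sum V _); lra.
- exists [:: (1, u), (-1, - u) & l0 c]; split; first by rewrite /= size_map.
    move=> x _; rewrite !fE l0E /= dotvNr -[in RHS](relu_subN (dotv _ u)); ring.
  by rewrite !kcE kE /= normrN1 normr1 norm2N; lra.
Qed.

(** Both normal forms agree by independence, so the neuron count can be taken from [l] and the
    bounds on [c] and [u] from [s]. *)
Lemma kappa_seq_le3 l s : (forall x, in_ball x -> f_meas l x = f_meas s x) ->
  exists l', [/\ (size l' <= size l)%N,
    forall x, in_ball x -> f_meas l' x = f_meas l x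
  & kappa_seq l' <= 3 * kappa_seq s].
Proof.
move=> ls.
have [V [c [u [[npV _] c0 lE _ sur]]]] := normal_form l nonparallel_nil.
(* The second normal form extends [V], so that [c] and [c'] can be compared over the single family
   [V']. *)
have [V' [c' [u' [[npV' sV] c0' sE [c's u's] _]]]] := normal_form s npV.
have [uV _ _] := npV; have [uV' _ _] := npV'.
rewrite addn0 in sur.
have [l' [size_l' l'E kl']] := surplus_realizable c uV sur.
exists l'; split=> // [x bx|]; first by rewrite l'E // lE.
have widen g : \sum_(v <- V) c v * g v = \sum_(v <- V') c v * g v.
  by rewrite (@big_seq_support _ _ V V') // => v vV; rewrite c0 // mul0r.
have [x bx|cc' /eqP] := @relu_sum_independent V' (fun v => c v - c' v) (u - u') npV'.
  have := ls x bx; rewrite lE // sE // /relu_sum widen => /eqP.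
  rewrite -subr_eq0 => /eqP e.
  rewrite (eq_bigr _ (fun v _ => mulrBl _ _ _)) sumrB dotvDr dotvNr -[RHS]e; ring.
rewrite subr_eq0 => /eqP uu'.
have cs : norm_sum V c = norm_sum V' c'.
  rewrite /norm_sum -(@big_seq_support _ _ V V') //; last first.
    by move=> v vV; rewrite c0 // normr0 mul0r.
  by apply: eq_big_seq => v /cc' /eqP; rewrite subr_eq0 => /eqP->.
by move: kl'; rewrite cs uu'; lra.
Qed.

(** * From networks to discrete measures on the sphere *)

(** Positive homogeneity moves each norm into the weight, zero vectors are dropped, and coinciding
    atoms are merged, which can only lower the total variation. *)
Lemma measure_of_seq l : exists s,
  [/\ fmeas_ok s, f_meas s =1 f_meas l & tv_meas s <= kappa_seq l].
Proof.
suff [V [c [uV sphV _ cE cl]]] : exists V c,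
    [/\ uniq V, forall v, v \in V -> in_sphere v, {in [predC V], c =1 (fun=> 0)},
      forall x, relu_sum V c (aug x) = f_meas l x
      & \sum_(v <- V) `|c v| <= kappa_seq l].
  exists [seq (c v, v) | v <- V]; split.
  - split; first by rewrite -map_comp map_id.
    by move=> p /mapP[v vV ->]; apply: sphV.
  - by move=> x; rewrite -cE /f_meas big_map.
  - by rewrite /tv_meas big_map.
elim: l => [|[a w] l [V [c [uV sphV c0 cE cl]]]].
  exists [::], (fun=> 0); split=> // [x|]; last by rewrite /kappa_seq !big_nil.
  by rewrite /f_meas /relu_sum !big_nil.
have kE : kappa_seq ((a, w) :: l) = `|a| * norm2 w + kappa_seq l.
  by rewrite /kappa_seq big_cons.
have fE x : f_meas ((a, w) :: l) x = a * relu (dotv (aug x) w) + f_meas l x.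
  by rewrite /f_meas big_cons.
have [w0|w0] := eqVneq (norm2 w) 0.
  exists V, c; split=> // [x|]; last by rewrite kE w0 mulr0 add0r.
  by rewrite fE cE (norm2_eq0 w0) dotv0r relu_ge0 // mulr0 add0r.
have wpos : 0 < norm2 w by rewrite lt_def w0 norm2_ge0.
pose v := (norm2 w)^-1 *: w.
have wE : w = norm2 w *: v by rewrite /v scalerA divff // scale1r.
have sv : in_sphere v by rewrite /in_sphere norm2Z gtr0_norm ?invr_gt0 // mulVf.
clearbody v.
(* Covers at once a new atom and one already in [V]. *)
pose V' := undup (v :: V).
have vV' : v \in V' by rewrite mem_undup mem_head.
have uV' : uniq V' by apply: undup_uniq.
have sVV' : {subset V <= V'} by move=> x xV; rewrite mem_undup inE xV orbT.
have c0' : {in [predC V'], c =1 (fun=> 0)}.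
  by move=> x; rewrite !inE => xV'; apply: c0; rewrite inE; apply: contra xV' => /sVV'.
exists V', (add_weight c v (a * norm2 w)); split=> //.
- by move=> x; rewrite mem_undup inE => /orP[/eqP->|/sphV].
- exact: add_weight_support.
- move=> x; rewrite /relu_sum sum_add_weight // fE -cE.
  rewrite (@big_seq_support _ _ V V') // => [|y yV]; last by rewrite c0 // mul0r.
  by rewrite [in RHS]wE dotvZr reluM ?norm2_ge0 // addrC mulrA.
- have := sum_norm_add_weight c (a * norm2 w) uV' vV' (g := fun=> 1) (fun=> ler01).
  under eq_bigr do rewrite mulr1; under [X in _ <= X + _]eq_bigr do rewrite mulr1.
  rewrite (@big_seq_support _ _ V V' (fun y => `|c y|)) // => [|y yV].
    by rewrite kE mulr1 normrM (ger0_norm (norm2_ge0 w)); lra.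
  by rewrite c0 // normr0.
Qed.

(** * Translation between parameter vectors and lists *)

Definition seq_of_par N (a : 'I_N -> R) (w : 'I_N -> 'rV[R]_(d + 1)) :=
  [seq (a i, w i) | i <- enum 'I_N].

Lemma fnn_seq N (a : 'I_N -> R) (w : 'I_N -> 'rV[R]_(d + 1)) :
  fnn a w =1 f_meas (seq_of_par a w).
Proof. by move=> x; rewrite /f_meas big_map big_enum. Qed.

Lemma kappa_par_seq N (a : 'I_N -> R) (w : 'I_N -> 'rV[R]_(d + 1)) :
  kappa_par a w = kappa_seq (seq_of_par a w).
Proof. by rewrite /kappa_seq big_map big_enum. Qed.

Lemma par_of_seq N l : (size l <= N)%N ->
  exists (a : 'I_N -> R) (w : 'I_N -> 'rV[R]_(d + 1)),
    fnn a w =1 f_meas l /\ kappa_par a w = kappa_seq l.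
Proof.
(* The default [(0, 0)] pads the list to exactly [N] neurons without changing the function or the
   cost. *)
move=> lN; pose p i := nth (0, 0) l i.
have sumE (g : R * 'rV[R]_(d + 1) -> R) :
    g (0, 0) = 0 -> \sum_(i < N) g (p i) = \sum_(q <- l) g q.
  move=> g0; rewrite (big_nth (0, 0)) -(big_mkord xpredT (fun i => g (p i))).
  rewrite (@big_cat_nat _ _ _ (size l)) //= -[RHS]addr0.
  congr (_ + _); rewrite big_nat big1 //.
  by move=> i /andP[li _]; rewrite /p nth_default.
exists (fun i => (p i).1), (fun i => (p i).2); split.
  by move=> x; apply: (sumE (fun q => q.1 * relu (dotv (aug x) q.2))); rewrite mul0r.
by apply: (sumE (fun q => `|q.1| * norm2 q.2)); rewrite normr0 mul0r.
Qed.

Lemma kappa_seq_ge0 l : 0 <= kappa_seq l.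
Proof. by apply: sumr_ge0 => p _; rewrite mulr_ge0 ?norm2_ge0. Qed.

Lemma kappa_seq_sphere s : fmeas_ok s -> kappa_seq s = tv_meas s.
Proof. by case=> _ sph; apply: eq_big_seq => p /sph ->; rewrite mulr1. Qed.

Lemma tv_meas_ge0 s : 0 <= tv_meas s.
Proof. exact: sumr_ge0. Qed.

End Ball.

Theorem theorem1 (R : realType) (d N : nat) (hd : (1 <= d)%N)
  (f : 'rV[R]_d -> R) (hf : in_NN N f) :
  kappa_fun f <= kappa_rep N f /\ kappa_rep N f <= 3 * kappa_fun f.
Proof.
have [a [w fE]] := hf; split.
  (* Every parameter vector yields a measure of no larger total variation; [hf] shows that the set
     of costs is nonempty. *)
  apply: lb_le_inf; first by exists (kappa_par a w), a, w.
  move=> _ [a' [w' [fE' ->]]]; rewrite kappa_par_seq.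
  have [s [sok sE sk]] := measure_of_seq (seq_of_par a' w').
  apply: le_trans sk; apply: ge_inf.
    by exists 0 => _ [s' [_ [_ ->]]]; apply: tv_meas_ge0.
  by exists s; split=> //; split=> // x bx; rewrite sE fE' // fnn_seq.
(* With the factor moved to the left, it suffices to bound [kappa_rep] by three times the variation
   of each admissible measure. *)
rewrite mulrC -ler_pdivrMr //; apply: lb_le_inf.
  have [s [sok sE _]] := measure_of_seq (seq_of_par a w).
  by exists (tv_meas s), s; split=> //; split=> // x bx; rewrite sE fE // fnn_seq.
move=> _ [s [sok [sE ->]]]; rewrite ler_pdivrMr // mulrC -kappa_seq_sphere //.
have [x bx|l [sl lE kl]] := @kappa_seq_le3 _ _ (seq_of_par a w) s.
  by rewrite -fnn_seq -fE // sE.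
apply: le_trans kl.
have [|a' [w' [fE' <-]]] := @par_of_seq _ _ N l.
  by rewrite (leq_trans sl) // size_map size_enum_ord.
apply: ge_inf.
  by exists 0 => _ [a1 [w1 [_ ->]]]; rewrite kappa_par_seq kappa_seq_ge0.
by exists a', w'; split=> // x bx; rewrite fE' lE // -fnn_seq fE.
Qed.
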